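(* Let $P$ be a set of sum-indecomposable (non-empty) permutations and let $n\ge0$. Then the staircase encoding $\mathrm{SE}$ is a bijection between $\mathrm{Av}^{(n)}(2413,3142,1\oplus P)$ and $\mathrm{WI}(\mathcal{D}(B_n),\mathrm{Av}^{+}(2413,3142,P))$.
   Context: A permutation of size $n$ is a word containing each of $1,\dots,n$ exactly once. $\sigma$ contains $\pi$ if some subsequence of $\sigma$ has the same relative order as $\pi$; otherwise $\sigma$ avoids $\pi$. $\mathrm{Av}(P)$ is the set of permutations avoiding every element of $P$, $\mathrm{Av}^{+}(P)$ its non-empty elements. For $\alpha$ of size $a$, $\beta$ of size $b$: $\alpha\oplus\beta=\alpha_1\cdots\alpha_a(\beta_1+a)\cdots(\beta_b+a)$. A permutation is sum-indecomposable if it cannot be written as $\alpha\oplus\beta$ with $\alpha,\beta$ non-empty. $1\oplus P=\{1\oplus\pi:\pi\in P\}$. The empty permutation is not in $P$. A left-to-right minimum of $\sigma$ is an entry $\sigma_i$ with $\sigma_j>\sigma_i$ for all $j<i$; $\mathrm{Av}^{(n)}(Q)$ is the set of permutations in $\mathrm{Av}(Q)$ with exactly $n$ left-to-right minima. The staircase grid is $B_n=\{(i,j):1\le i\le j\le n\}$ (row $i$, column $j$, row 1 on top). If $\sigma$ has left-to-right minima at positions $p_1<\dots<p_n$ with values $v_1>\dots>v_n$, each non-minimum entry $\sigma_k$ lies in cell $(i,j)$ where $j$ is the largest index with $p_j<k$ and $i$ the smallest index with $v_i<\sigma_k$. The staircase encoding $\mathrm{SE}(\sigma)$ is the filling of $B_n$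 putting in each cell the standardization of the entries of $\sigma$ in that cell (empty permutation if none). The down-core $\mathcal{D}(B_n)$ is the graph on $B_n$ with an edge between $(i,j)$ and $(k,\ell)$ whenever $i<k$, $j<\ell$ and the rectangle $\{i,\dots,k\}\times\{j,\dots,\ell\}$ is a subset of $B_n$. For a graph $G$ on $B_n$ and a set $S$ of non-empty permutations, $\mathrm{WI}(G,S)$ is the set of fillings of $B_n$ whose non-empty cells form an independent set of $G$ and all contain elements of $S$. ''SE is a bijection between $X$ and $Y$'' means SE restricted to $X$ is injective with image exactly $Y$. *)

(* Defs.v *)
From mathcomp Require Import all_boot.
From mathcomp Require Import boolp classical_sets functions.

Set Implicit Arguments.
Unset Strict Implicit.
Unset Printing Implicit Defensive.

Local Open Scope classical_set_scope.

Definition is_perm (s : seq nat) : bool := perm_eq s (iota 1 (size s)).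

Definition same_order (s t : seq nat) : Prop :=
  size s = size t /\
  forall i j, i < size s -> j < size s ->
    (nth 0 s i < nth 0 s j) = (nth 0 t i < nth 0 t j).

Definition contains (s p : seq nat) : Prop :=
  exists2 t, subseq t s & same_order t p.

Definition Av (Q : set (seq nat)) : set (seq nat) :=
  [set s | is_perm s /\ forall p, Q p -> ~ contains s p].

Definition Avp (Q : set (seq nat)) : set (seq nat) :=
  [set s | Av Q s /\ s <> [::]].

Definition osum (a b : seq nat) : seq nat := a ++ [seq x + size a | x <- b].

Definition sum_indecomposable (s : seq nat) : Prop :=
  ~ exists a b, [/\ is_perm a, is_perm b, a <> [::], b <> [::] & s = osum a b].

(* Positions of a word, and indices of rows and columns, are counted from 0. *)
Definition is_lrmin (s : seq nat) (k : nat) : bool :=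
  all (fun x => nth 0 s k < x) (take k s).

Definition lrmins (s : seq nat) : seq nat :=
  [seq k <- iota 0 (size s) | is_lrmin s k].

Definition lrmin_pos (s : seq nat) (j : nat) : nat := nth 0 (lrmins s) j.

Definition lrmin_val (s : seq nat) (j : nat) : nat := nth 0 s (lrmin_pos s j).

Definition Avn (n : nat) (Q : set (seq nat)) : set (seq nat) :=
  [set s | Av Q s /\ size (lrmins s) = n].

Definition in_staircase (n : nat) (c : 'I_n * 'I_n) : bool := c.1 <= c.2.

Definition cell (n : nat) := {c : 'I_n * 'I_n | in_staircase c}.

Definition row n (c : cell n) : 'I_n := (val c).1.
Definition col n (c : cell n) : 'I_n := (val c).2.

(* Cells hold arbitrary words; membership in [WI] forces them to be
   permutations. *)
Definition filling (n : nat) := {ffun cell n -> seq nat}.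

(* On words with distinct letters, the permutation in the same relative order. *)
Definition std (s : seq nat) : seq nat :=
  [seq count (fun y => y <= x) s | x <- s].

(* Meaningful when [s] has exactly [n] left-to-right minima. *)
Definition in_cell n (s : seq nat) (c : cell n) (k : nat) : bool :=
  [&& ~~ is_lrmin s k,
      lrmin_pos s (col c) < k,
      [forall j : 'I_n, (lrmin_pos s j < k) ==> (j <= col c)],
      lrmin_val s (row c) < nth 0 s k &
      [forall i : 'I_n, (lrmin_val s i < nth 0 s k) ==> (row c <= i)]].

Definition SE (n : nat) (s : seq nat) : filling n :=
  [ffun c : cell n =>
    std [seq nth 0 s k | k <- iota 0 (size s) & in_cell s c k]].

Definition down_edge n (c d : cell n) : bool :=
  [&& row c < row d, col c < col d &
      [forall x : 'I_n * 'I_n,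
         (row c <= x.1 <= row d) && (col c <= x.2 <= col d)
         ==> in_staircase x]].

Definition down_core (n : nat) : rel (cell n) :=
  fun c d => down_edge c d || down_edge d c.

Definition WI n (G : rel (cell n)) (S : set (seq nat)) : set (filling n) :=
  [set f | (forall c d, f c <> [::] -> f d <> [::] -> ~~ G c d) /\
           (forall c, f c <> [::] -> S (f c))].

(* Main.v *)
Require Import Defs.
From mathcomp Require Import all_boot all_order.
From mathcomp Require Import classical_sets functions.
From mathcomp Require Import zify.

Set Implicit Arguments.
Unset Strict Implicit.
Unset Printing Implicit Defensive.

Import Order.TTheory.

(* Put the j-th left-to-right minimum in the diagonal cell (j, j), and read the
   cell (i, j) as the interval [i, j].  In a permutation avoiding 2413 and 3142,
   an ascent nests the interval of its first entry in that of the second, while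
   the two intervals of a descent are equal or disjoint.  So the occupied cells
   form a laminar family, which is independence in the down-core, and the order
   of two entries in different cells can be read off from the cells: the
   contents of the cells determine the permutation, and any independent filling
   arises.  Laminarity confines every occurrence of 2413 or 3142 to one cell.  In
   an occurrence of 1 + p, the intervals of the entries of p all contain that of
   the first entry, hence form a chain along which the entries ascend, and an
   indecomposable p must lie in one cell. *)

Lemma sorted_subseq_iota I n :
  sorted ltn I -> all (gtn n) I -> subseq I (iota 0 n).
Proof.
move=> I_sorted /allP I_lt.
suff -> : I = [seq k <- iota 0 n | k \in I] by apply: filter_subseq.
apply: lt_sorted_eq => //.
  by apply: sorted_filter; [exact: ltn_trans | exact: iota_ltn_sorted].
move=> k; rewrite mem_filter mem_iota /= add0n.
by case k_in: (k \in I) => //=; have /= -> := I_lt _ k_in.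
Qed.

Lemma eq_pairwise_filter (T K : eqType) (key : T -> K) (le : rel K) (s t : seq T) :
  antisymmetric le -> pairwise (relpre key le) s -> pairwise (relpre key le) t ->
  {in s ++ t, forall z,
    [seq x <- s | key x == key z] = [seq x <- t | key x == key z]} ->
  s = t.
Proof.
move=> le_anti; elim: s t => [|x s IHs] [|y t] // le_s le_t same_block.
- by have := same_block y (mem_head _ _); rewrite /= eqxx.
- by have := same_block x (mem_head _ _); rewrite /= eqxx.
have x_in : x \in (x :: s) ++ y :: t by rewrite mem_cat mem_head.
have y_in : y \in (x :: s) ++ y :: t by rewrite mem_cat mem_head orbT.
have x_t : x \in y :: t.
  have : x \in [seq z <- x :: s | key z == key x] by rewrite mem_filter eqxx mem_head.
  by rewrite same_block // mem_filter => /andP[].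
have y_s : y \in x :: s.
  have : y \in [seq z <- y :: t | key z == key y] by rewrite mem_filter eqxx mem_head.
  by rewrite -same_block // mem_filter => /andP[].
move: le_s le_t => /= /andP[/allP le_x le_s] /andP[/allP le_y le_t].
have key_xy : key x = key y.
  move: x_t y_s; rewrite !inE => /predU1P[->//|/le_y le_yx] /predU1P[->//|/le_x le_xy].
  exact/le_anti/andP.
have xy : x = y by have := same_block x x_in; rewrite /= key_xy !eqxx => -[].
rewrite -xy; congr (_ :: _); apply: IHs => // z; rewrite mem_cat => z_in.
have z_in_cons : z \in (x :: s) ++ y :: t.
  by rewrite mem_cat !inE; case/orP: z_in => ->; rewrite ?orbT.
by have := same_block z z_in_cons; rewrite /= -xy; case: eqP => // _ [].
Qed.

Lemma pairwise_allpairs_dep (S T U : eqType) (F : S -> T -> U) (e : rel U) (r : rel S)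
    (t : S -> seq T) (s : seq S) :
  (forall x, pairwise (fun v w => e (F x v) (F x w)) (t x)) ->
  (forall x y v w, r x y -> e (F x v) (F y w)) ->
  pairwise r s -> pairwise e [seq F x v | x <- s, v <- t x].
Proof.
move=> e_fiber e_base; elim: s => [|x s IHs] //= /andP[/allP r_x r_s].
rewrite pairwise_cat IHs // andbT pairwise_map e_fiber andbT.
apply/allrelP => _ _ /mapP[v _ ->] /allpairsPdep[y [w [y_s _ ->]]].
exact/e_base/r_x.
Qed.

Lemma filter_allpairs_dep (S : eqType) (T U : Type) (F : S -> T -> U) (a : pred U)
    (t : S -> seq T) (s : seq S) x :
  (forall y v, a (F y v) = (y == x)) -> uniq s ->
  [seq z <- [seq F y v | y <- s, v <- t y] | a z] =
  if x \in s then [seq F x v | v <- t x] else [::].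
Proof.
move=> aF; elim: s => [|y s IHs] //= /andP[y_s s_uniq].
rewrite filter_cat IHs // filter_map (eq_filter (aF y)) inE [x == y]eq_sym.
case: eqP y_s => [->|_] y_s /=; last by rewrite filter_pred0.
by rewrite filter_predT (negbTE y_s) cats0.
Qed.

Section RankSeq.
Variables (d : Order.disp_t) (T : orderType d).
Implicit Types (x y : T) (s : seq T).

Definition rank_seq s : seq nat := [seq count (<= x)%O s | x <- s].

Lemma size_rank_seq s : size (rank_seq s) = size s.
Proof. exact: size_map. Qed.

Lemma ltn_count_le s :
  {in s &, forall x y, (count (<= x)%O s < count (<= y)%O s) = (x < y)%O}.
Proof.
move=> x y x_s y_s; case: ltP => [xy|yx]; last first.
  by rewrite ltnNge sub_count // => z /= /le_trans->.
apply: (@leq_ltn_trans (count (< y)%O s)); last by rewrite count_lt_le_mem.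
by apply: sub_count => z /= /le_lt_trans->.
Qed.

Lemma ltn_rank_seq x0 s i j : i < size s -> j < size s ->
  (nth 0 (rank_seq s) i < nth 0 (rank_seq s) j) = (nth x0 s i < nth x0 s j)%O.
Proof. by move=> lt_i lt_j; rewrite !(nth_map x0) // ltn_count_le ?mem_nth. Qed.

Lemma is_perm_rank_seq s : uniq s -> is_perm (rank_seq s).
Proof.
move=> s_uniq; have ranks_uniq : uniq (rank_seq s).
  rewrite map_inj_in_uniq // => x y x_s y_s rank_xy.
  have := ltn_count_le x_s y_s; have := ltn_count_le y_s x_s.
  by rewrite rank_xy ltnn; case: ltgtP.
have ranks_sub : {subset rank_seq s <= iota 1 (size (rank_seq s))}.
  move=> _ /mapP[x x_s ->]; rewrite mem_iota size_rank_seq add1n ltnS count_size andbT.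
  by rewrite -has_count; apply/hasP; exists x => /=.
have [|_ same_mem] := uniq_min_size ranks_uniq ranks_sub; first by rewrite size_iota.
by rewrite /is_perm uniq_perm // iota_uniq.
Qed.

End RankSeq.

Lemma std_rank_seq s : std s = rank_seq s. Proof. by []. Qed.

Lemma same_order_sym s t : same_order s t -> same_order t s.
Proof. by case=> st so; split=> // i j lt_i lt_j; rewrite so // st. Qed.

Lemma same_order_trans s t u :
  same_order s t -> same_order t u -> same_order s u.
Proof.
by case=> st so [tu so']; split=> [|i j lt_i lt_j]; rewrite ?st // so // so' // -st.
Qed.

Lemma same_order_mapP (T : eqType) (a b : T -> nat) (I : seq T) :
  same_order (map a I) (map b I) <->
  {in I &, forall x y, (a x < a y) = (b x < b y)}.
Proof.
split=> [[_ so] x y x_I y_I|so].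
  have := so (index x I) (index y I).
  by rewrite size_map !index_mem !(nth_map x) ?index_mem // !nth_index //; apply.
case: I so => [|x0 I] so; first by split.
by split=> [|i j]; rewrite !size_map // => *; rewrite !(nth_map x0) // so ?mem_nth.
Qed.

Lemma same_order_sortedP t p J : perm_eq J (iota 0 (size p)) ->
  sorted ltn (map (nth 0 p) J) ->
  same_order t p <-> size t = size p /\ sorted ltn (map (nth 0 t) J).
Proof.
move=> J_perm p_J; have mem_J i : (i \in J) = (i < size p).
  by rewrite (perm_mem J_perm) mem_iota.
split=> [[tp so]|[tp t_J]].
  split=> //; move: p_J; rewrite !sorted_map.
  rewrite (@eq_in_sorted _ (mem J) (relpre (nth 0 p) ltn) (relpre (nth 0 t) ltn)) //.
  by move=> i j i_J j_J /=; rewrite -so // tp -mem_J.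
split=> // i j; rewrite tp -!mem_J => i_J j_J.
have index_mono u : sorted ltn (map (nth 0 u) J) ->
    (nth 0 u i < nth 0 u j) = (index i J < index j J).
  move=> /(lt_sorted_ltn_nth 0)/(_ (index i J) (index j J)).
  by rewrite !inE size_map !index_mem !(nth_map 0) ?index_mem // !nth_index //; apply.
by rewrite !index_mono.
Qed.

Lemma same_order_std s : same_order s (std s).
Proof.
by split=> [|i j lt_i lt_j]; rewrite std_rank_seq ?size_rank_seq ?(ltn_rank_seq 0).
Qed.

Lemma eq_std s t : same_order s t -> std s = std t.
Proof.
case=> st so; apply: (@eq_from_nth _ 0) => [|i]; rewrite !size_map // => lt_i.
rewrite !(nth_map 0) -?st //.
rewrite -[X in count _ X](mkseq_nth 0 s) -[X in _ = count _ X](mkseq_nth 0 t).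
rewrite !count_map -st; apply: eq_in_count => j; rewrite mem_iota /= => lt_j.
by rewrite leqNgt [RHS]leqNgt so.
Qed.

Lemma is_perm_uniq s : is_perm s -> uniq s.
Proof. by move/perm_uniq->; apply: iota_uniq. Qed.

Lemma is_perm_gt0 p x : is_perm p -> x \in p -> 0 < x.
Proof. by move=> /perm_mem->; rewrite mem_iota => /andP[]. Qed.

Lemma std_perm p : is_perm p -> std p = p.
Proof.
move=> p_perm; rewrite -[RHS]map_id; apply/eq_in_map => x.
rewrite (perm_mem p_perm) mem_iota => x_range; rewrite (permP p_perm).
have := @count_le_nth _ nat 0 _ x.-1 (iota_ltn_sorted 1 (size p)).
by rewrite size_iota nth_iota; [move=> /(_ _); rewrite add1n prednK; [apply|]|]; lia.
Qed.

Lemma perm_same_order s t : is_perm s -> is_perm t -> same_order s t -> s = t.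
Proof. by move=> /std_perm {2}<- /std_perm {2}<- /eq_std. Qed.

Lemma osum_of_allrel u v : is_perm (u ++ v) -> allrel ltn u v ->
  exists2 w, is_perm u /\ is_perm w & u ++ v = osum u w.
Proof.
move=> uv_perm /allrelP u_lt_v.
have sort_uv : sort leq u ++ sort leq v = iota 1 (size u + size v).
  apply: (sorted_eq leq_trans anti_leq).
  - rewrite (sorted_pairwise leq_trans) pairwise_cat -!(sorted_pairwise leq_trans).
    rewrite !(sort_sorted leq_total) !andbT; apply/allrelP => x y.
    by rewrite !mem_sort => /u_lt_v lt_x /lt_x /ltnW.
  - exact: iota_sorted.
  - by rewrite -size_cat; apply: perm_trans uv_perm; apply: perm_cat; rewrite perm_sort.
have [sort_u sort_v] :
    sort leq u = iota 1 (size u) /\ sort leq v = iota (1 + size u) (size v).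
  move/eqP: sort_uv; rewrite iotaD eqseq_cat; first by move=> /andP[/eqP-> /eqP->].
  by rewrite size_sort size_iota.
have shiftK : [seq x + size u | x <- [seq x - size u | x <- v]] = v.
  rewrite -map_comp -[RHS]map_id; apply/eq_in_map => x /=.
  by rewrite -(mem_sort leq) sort_v mem_iota; lia.
exists [seq x - size u | x <- v]; last by rewrite /osum shiftK.
split; first by rewrite /is_perm -sort_u perm_sym perm_sort.
rewrite /is_perm size_map; apply: (perm_map_inj (@addIn (size u))); rewrite shiftK.
under [X in perm_eq _ X]eq_map do rewrite addnC.
by rewrite -iotaDl addnC -sort_v perm_sym perm_sort.
Qed.

(* Otherwise cut [p] where the label first changes: by convexity the labels on
   the two sides of the cut differ, so the cut writes [p] as a sum. *)
Lemma sum_indecomposable_const (T : eqType) (L : nat -> T) p :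
  is_perm p -> sum_indecomposable p ->
  (forall i j k, i <= j <= k -> k < size p -> L i = L k -> L i = L j) ->
  (forall i j, i < j < size p -> L i <> L j -> nth 0 p i < nth 0 p j) ->
  forall i, i < size p -> L i = L 0.
Proof.
move=> p_perm p_ind convex asc k lt_k; apply/eqP; apply: contraPT p_ind => L_k.
have [] := @ex_minnP (fun k => (k < size p) && (L k != L 0)).
  by exists k; rewrite lt_k.
move=> a /andP[lt_a L_a] a_min; apply; rewrite -(cat_take_drop a p) in p_perm *.
have size_take_a : size (take a p) = a by rewrite size_takel // ltnW.
have a_gt0 : 0 < a by case: a L_a {lt_a a_min size_take_a p_perm}; rewrite ?eqxx.
have [|w [take_perm w_perm] p_sum] := osum_of_allrel p_perm.
  apply/allrelP => _ _ /(nthP 0)[i + <-] /(nthP 0)[j + <-].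
  rewrite size_take_a size_drop nth_drop => lt_i lt_j; rewrite nth_take //=.
  have L_i : L i = L 0.
    by apply/eqP/negPn/negP => L_i; have := a_min i; rewrite L_i; lia.
  apply: asc => [|L_ij]; first by rewrite ltn_addr // -ltn_subRL.
  suff L_ia : L i = L a by rewrite -L_ia L_i eqxx in L_a.
  by apply: convex L_ij; rewrite ?(ltnW lt_i) ?leq_addr // -ltn_subRL.
exists (take a p), w; split=> //.
- by move/(congr1 size); rewrite size_take_a /=; lia.
- move=> w_nil; have := congr1 size p_sum.
  by rewrite w_nil cat_take_drop /osum cats0 size_take_a; lia.
Qed.

Definition occurs_at (s p I : seq nat) : Prop :=
  [/\ sorted ltn I, all (gtn (size s)) I & same_order (map (nth 0 s) I) p].

Lemma occurs_at_lt s p I i : occurs_at s p I -> i \in I -> i < size s.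
Proof. by case=> _ /allP I_lt _ /I_lt. Qed.

Lemma size_occurs_at s p I : occurs_at s p I -> size I = size p.
Proof. by case=> _ _ [<-]; rewrite size_map. Qed.

Lemma contains_filterP s (Q : pred nat) p :
  contains [seq nth 0 s k | k <- iota 0 (size s) & Q k] p <->
  exists2 I, occurs_at s p I & all Q I.
Proof.
have iota_lt : sorted ltn (iota 0 (size s)) by apply: iota_ltn_sorted.
split=> [[t /subseqP[m _ ->] so]|[I [I_sorted I_lt so] Q_I]].
  exists (mask m [seq k <- iota 0 (size s) | Q k]); last first.
    by apply/allP => k /mem_mask; rewrite mem_filter => /andP[].
  split; last by rewrite map_mask.
  - exact/(subseq_sorted ltn_trans (mask_subseq _ _))/(sorted_filter ltn_trans).
  - by apply/allP => k /mem_mask; rewrite mem_filter mem_iota => /andP[].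
exists (map (nth 0 s) I) => //; apply: map_subseq.
by rewrite subseq_filter Q_I sorted_subseq_iota.
Qed.

Lemma containsP s p : contains s p <-> exists I, occurs_at s p I.
Proof.
have := contains_filterP s predT p; rewrite filter_predT -/(mkseq _ _) mkseq_nth => ->.
by split=> [[I]|[I]]; exists I => //; apply: all_predT.
Qed.

Lemma contains_same_order s t p : same_order s t -> contains s p -> contains t p.
Proof.
case=> st so /containsP[I [I_sorted I_lt I_p]]; apply/containsP; exists I.
split=> //; rewrite -?st //; apply: same_order_trans I_p.
apply/same_order_sym/same_order_mapP => x y x_I y_I.
by rewrite so //; apply: (allP I_lt).
Qed.

Lemma contains_std s p : contains (std s) p <-> contains s p.
Proof.
have so := same_order_std s.
by split; apply: contains_same_order => //; apply: same_order_sym.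
Qed.

Lemma contains_nil p : contains [::] p -> p = [::].
Proof. by case=> t; rewrite subseq0 => /eqP-> [/esym/size0nil]. Qed.

Lemma same_order_osum1 x u p : is_perm p ->
  same_order (x :: u) (osum [:: 1] p) <-> all (ltn x) u /\ same_order u p.
Proof.
move=> p_perm; rewrite /osum /=.
have nth_p j : j < size p -> nth 0 [seq y + 1 | y <- p] j = (nth 0 p j).+1.
  by move=> lt_j; rewrite (nth_map 0) // addn1.
have gt0 j : j < size p -> 0 < nth 0 p j.
  by move=> lt_j; apply: is_perm_gt0 (mem_nth _ _).
split=> [[/= [+] so]|[/allP x_u [up so]]].
  rewrite size_map => up; split; last first.
    split=> // i j lt_i lt_j; have /= -> := so i.+1 j.+1 lt_i lt_j.
    by rewrite !nth_p -?up.
  apply/(all_nthP 0) => j lt_j; have /= -> := so 0 j.+1 isT lt_j.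
  by rewrite nth_p -?up // ltnS gt0 -?up.
split=> [|[|i] [|j]] /=; rewrite ?size_map ?up ?ltnS ?ltnn // => lt_i lt_j.
- by rewrite nth_p // ltnS gt0 //; apply: x_u; rewrite mem_nth ?up.
- by rewrite nth_p // ltnNge ltnW //; apply: x_u; rewrite mem_nth ?up.
- by rewrite !nth_p // ltnS so ?up.
Qed.

Lemma occurs_at_osum1 s p x J : is_perm p ->
  occurs_at s (osum [:: 1] p) (x :: J) <->
  [/\ x < size s, {in J, forall i, x < i /\ nth 0 s x < nth 0 s i} & occurs_at s p J].
Proof.
move=> p_perm; have so_cons := same_order_osum1 (nth 0 s x) (map (nth 0 s) J) p_perm.
rewrite /occurs_at /= (path_sortedE ltn_trans); split.
  case=> /andP[/allP x_J J_sorted] /andP[lt_x J_lt] /so_cons[].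
  rewrite all_map => /allP s_x so; split=> // i i_J; split; first exact: x_J.
  exact: s_x.
case=> lt_x x_J [-> -> so]; rewrite lt_x andbT; split=> //.
  by apply/allP => i /x_J[].
by apply/so_cons; split=> //; rewrite all_map; apply/allP => i /x_J[].
Qed.

Definition separable_basis : set (seq nat) :=
  [set [:: 2; 4; 1; 3]; [:: 3; 1; 4; 2]]%classic.

Lemma occurs_at_2413 s a b c d : occurs_at s [:: 2; 4; 1; 3] [:: a; b; c; d] <->
  [/\ a < b, b < c, c < d & d < size s] /\
  [/\ nth 0 s c < nth 0 s a, nth 0 s a < nth 0 s d & nth 0 s d < nth 0 s b].
Proof.
have so := @same_order_sortedP [seq nth 0 s k | k <- [:: a; b; c; d]]
  [:: 2; 4; 1; 3] [:: 2; 0; 3; 1] isT isT.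
split=> [[/= lt_I I_lt /so[_ /= ]]|[[ab bc cd lt_d] [ca ad db]]].
  by move=> lt_v; split; split; lia.
by split; [rewrite /=; lia | rewrite /=; lia | apply/so; split=> //=; lia].
Qed.

Lemma occurs_at_3142 s a b c d : occurs_at s [:: 3; 1; 4; 2] [:: a; b; c; d] <->
  [/\ a < b, b < c, c < d & d < size s] /\
  [/\ nth 0 s b < nth 0 s d, nth 0 s d < nth 0 s a & nth 0 s a < nth 0 s c].
Proof.
have so := @same_order_sortedP [seq nth 0 s k | k <- [:: a; b; c; d]]
  [:: 3; 1; 4; 2] [:: 1; 3; 0; 2] isT isT.
split=> [[/= lt_I I_lt /so[_ /= ]]|[[ab bc cd lt_d] [bd da ac]]].
  by move=> lt_v; split; split; lia.
by split; [rewrite /=; lia | rewrite /=; lia | apply/so; split=> //=; lia].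
Qed.

Definition row_index (s : seq nat) k :=
  count (fun p => nth 0 s k < nth 0 s p) (lrmins s).

Definition col_index (s : seq nat) k := (count (fun p => p <= k) (lrmins s)).-1.

Definition label s k : nat * nat := (row_index s k, col_index s k).

Lemma is_lrminP s k : k < size s ->
  reflect (forall i, i < k -> nth 0 s k < nth 0 s i) (is_lrmin s k).
Proof.
move=> lt_k; have size_k : size (take k s) = k by rewrite size_takel // ltnW.
apply: (iffP (all_nthP 0)); rewrite size_k => lt_min i lt_i; have := lt_min i lt_i;
  by rewrite nth_take.
Qed.

Lemma mem_lrmins s k : (k \in lrmins s) = (k < size s) && is_lrmin s k.
Proof. by rewrite mem_filter mem_iota andbC. Qed.

Lemma lrmins_sorted s : sorted ltn (lrmins s).
Proof. by apply: sorted_filter; [exact: ltn_trans | exact: iota_ltn_sorted]. Qed.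

Section LeftToRightMinima.
Variable s : seq nat.
Local Notation m := (size (lrmins s)).

Lemma lrmin_posP j : j < m -> lrmin_pos s j < size s /\ is_lrmin s (lrmin_pos s j).
Proof. by move=> /(mem_nth 0); rewrite mem_lrmins => /andP. Qed.

Lemma ltn_lrmin_pos i j : i < m -> j < m -> (lrmin_pos s i < lrmin_pos s j) = (i < j).
Proof. exact: (lt_sorted_ltn_nth 0 (lrmins_sorted s)). Qed.

Lemma ltn_lrmin_val i j : i < j -> j < m -> lrmin_val s j < lrmin_val s i.
Proof.
move=> ij lt_j; have [lt_pj /(is_lrminP lt_pj)] := lrmin_posP lt_j.
by apply; rewrite ltn_lrmin_pos // (ltn_trans ij).
Qed.

Lemma leq_lrmin_pos j k : j < m -> k < size s ->
  (lrmin_pos s j <= k) = (j <= col_index s k).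
Proof.
move=> lt_j lt_k.
have le_sorted : sorted <=%O (lrmins s) := sub_sorted ltnW (lrmins_sorted s).
have first_min : 0 < count (<= k)%O (lrmins s).
  rewrite -has_count; apply/hasP; exists 0; rewrite //= mem_lrmins.
  by rewrite (leq_ltn_trans _ lt_k) // /is_lrmin take0.
rewrite /col_index -[RHS]ltnS prednK //; apply/idP/idP => [|lt_count].
  apply: contraLR; rewrite -leqNgt -ltnNge => le_count.
  by apply: (@nth_count_gt _ nat) le_sorted _; rewrite le_count.
exact: (@nth_count_le _ nat) le_sorted lt_count.
Qed.

Lemma ltn_lrmin_val_row j k : j < m ->
  (nth 0 s k < lrmin_val s j) = (j < row_index s k).
Proof.
move=> lt_j; pose vals : seq nat^d := map (nth 0 s) (lrmins s).
have vals_sorted : sorted <=%O vals.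
  rewrite (sorted_pairwise le_trans); apply/(pairwiseP 0) => i l.
  rewrite !inE size_map leEdual => lt_i lt_l il; rewrite !(nth_map 0) //.
  exact/ltnW/ltn_lrmin_val.
rewrite /row_index -(count_map (nth 0 s) (fun v => nth 0 s k < v)).
have -> : lrmin_val s j = nth 0 vals j by rewrite (nth_map 0).
apply/idP/idP => [|lt_count].
  apply: contraLR; rewrite -!leqNgt => le_count.
  apply: (@nth_count_ge _ nat^d (nth 0 s k)) vals_sorted _.
  by rewrite le_count size_map.
exact: (@nth_count_lt _ nat^d (nth 0 s k)) vals_sorted lt_count.
Qed.

Lemma exists_lrmin_below k : k < size s ->
  exists j, [/\ j < m, lrmin_pos s j <= k & lrmin_val s j <= nth 0 s k].
Proof.
elim/ltn_ind: k => k IHk lt_k; have [k_min|] := boolP (is_lrmin s k).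
  have k_in : k \in lrmins s by rewrite mem_lrmins lt_k.
  exists (index k (lrmins s)).
  by rewrite /lrmin_val /lrmin_pos index_mem k_in nth_index.
case/allPn => x /(nthP 0)[i]; rewrite size_takel ?(ltnW lt_k) // => ik.
rewrite nth_take // => <-; rewrite -leqNgt => le_ik.
have [j [lt_j pos_j val_j]] := IHk i ik (ltn_trans ik lt_k).
by exists j; split=> //; [apply: leq_trans pos_j (ltnW ik) | apply: leq_trans le_ik].
Qed.

Lemma ltn_col_index k : k < size s -> col_index s k < m.
Proof.
move=> lt_k; have [j [lt_j _ _]] := exists_lrmin_below lt_k.
by rewrite /col_index; have := count_size (fun p => p <= k) (lrmins s); lia.
Qed.

Lemma leq_row_col k : k < size s -> row_index s k <= col_index s k.
Proof.
move=> lt_k; have [j [lt_j pos_j val_j]] := exists_lrmin_below lt_k.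
rewrite leq_lrmin_pos // in pos_j; apply: leq_trans pos_j.
by rewrite leqNgt -ltn_lrmin_val_row // -leqNgt.
Qed.

Lemma ltn_row_index k : k < size s -> row_index s k < m.
Proof.
move=> lt_k; exact: leq_ltn_trans (leq_row_col lt_k) (ltn_col_index lt_k).
Qed.

Lemma leq_col_index i j : i <= j -> col_index s i <= col_index s j.
Proof.
move=> ij; rewrite /col_index -!subn1 leq_sub2r //; apply: sub_count => p /=.
by move/leq_trans; apply.
Qed.

Lemma leq_row_index i j : nth 0 s i <= nth 0 s j -> row_index s j <= row_index s i.
Proof. by move=> ij; apply: sub_count => p /=; apply: leq_ltn_trans. Qed.

Lemma label_lrmin_pos j : j < m -> label s (lrmin_pos s j) = (j, j).
Proof.
move=> lt_j; have [lt_p _] := lrmin_posP lt_j.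
have col_j : col_index s (lrmin_pos s j) = j.
  apply/eqP; rewrite eqn_leq -leq_lrmin_pos // leqnn andbT.
  rewrite leqNgt -ltn_lrmin_pos ?ltn_col_index // -leqNgt.
  by rewrite leq_lrmin_pos ?ltn_col_index.
rewrite /label col_j; congr (_, _); apply/eqP; rewrite eqn_leq -{1}[X in _ <= X]col_j.
rewrite leq_row_col // leqNgt; apply/negP => row_lt.
have := ltn_lrmin_val row_lt lt_j.
by rewrite [lrmin_val s j]/lrmin_val ltn_lrmin_val_row ?ltnn // (ltn_trans row_lt).
Qed.

Lemma lrmin_pos_col k : k < size s -> is_lrmin s k -> lrmin_pos s (col_index s k) = k.
Proof.
move=> lt_k k_min; have : k \in lrmins s by rewrite mem_lrmins lt_k.
case/(nthP 0) => j lt_j; rewrite -/(lrmin_pos s j) => <-.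
by have [_ ->] := label_lrmin_pos lt_j.
Qed.

Lemma lrmin_row_col k : k < size s -> is_lrmin s k -> row_index s k = col_index s k.
Proof.
move=> lt_k k_min; have := label_lrmin_pos (ltn_col_index lt_k).
by rewrite lrmin_pos_col // => -[].
Qed.

Lemma lrmin_first i j : i < size s -> j < size s -> is_lrmin s i ->
  label s i = label s j -> i <= j /\ nth 0 s i <= nth 0 s j.
Proof.
move=> lt_i lt_j i_min [row_ij col_ij]; have i_pos := lrmin_pos_col lt_i i_min.
split; first by rewrite -i_pos leq_lrmin_pos ?ltn_col_index // col_ij.
rewrite -[in nth 0 s i]i_pos -/(lrmin_val s _) leqNgt.
by rewrite ltn_lrmin_val_row ?ltn_col_index // -(lrmin_row_col lt_i) // row_ij ltnn.
Qed.

Lemma ltn_lrmin_pos_nonmin j k : j < m -> k < size s -> ~~ is_lrmin s k ->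
  (lrmin_pos s j < k) = (j <= col_index s k).
Proof.
move=> lt_j lt_k k_nonmin.
rewrite -leq_lrmin_pos // [RHS]leq_eqVlt orb_idl // => /eqP pos_j.
by have [_] := lrmin_posP lt_j; rewrite pos_j (negbTE k_nonmin).
Qed.

Lemma ltn_lrmin_val_nonmin j k : uniq s -> j < m -> k < size s -> ~~ is_lrmin s k ->
  (lrmin_val s j < nth 0 s k) = (row_index s k <= j).
Proof.
move=> s_uniq lt_j lt_k k_nonmin; have [lt_p p_min] := lrmin_posP lt_j.
rewrite [RHS]leqNgt -ltn_lrmin_val_row // -leqNgt [RHS]leq_eqVlt orb_idl //.
by rewrite nth_uniq // => /eqP pos_j; rewrite pos_j (negbTE k_nonmin) in p_min.
Qed.

End LeftToRightMinima.

Definition occupies s (x : nat * nat) k := ~~ is_lrmin s k && (label s k == x).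

Definition interval n (c : cell n) : nat * nat := (row c : nat, col c : nat).

Lemma interval_inj n : injective (@interval n).
Proof.
move=> c d [/val_inj row_cd /val_inj col_cd]; apply/val_inj.
rewrite (surjective_pairing (val c)) (surjective_pairing (val d)).
by congr (_, _); [exact: row_cd | exact: col_cd].
Qed.

Lemma interval_leq n (c : cell n) : (interval c).1 <= (interval c).2.
Proof. exact: (valP c). Qed.

Lemma exists_interval n i j : i <= j -> j < n -> exists c : cell n, interval c = (i, j).
Proof.
move=> ij lt_j; have lt_i := leq_ltn_trans ij lt_j.
have in_n : in_staircase (Ordinal lt_i, Ordinal lt_j) by [].
by exists (Sub _ in_n); rewrite /interval /row /col SubK.
Qed.

Lemma in_cellE n s (c : cell n) k : uniq s -> size (lrmins s) = n -> k < size s ->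
  in_cell s c k = occupies s (interval c) k.
Proof.
move=> s_uniq s_n lt_k; rewrite /in_cell /occupies.
case: (boolP (is_lrmin s k)) => //= k_nonmin.
have posE (j : 'I_n) : (lrmin_pos s j < k) = (j <= col_index s k).
  by rewrite ltn_lrmin_pos_nonmin ?s_n.
have valE (i : 'I_n) : (lrmin_val s i < nth 0 s k) = (row_index s k <= i).
  by rewrite ltn_lrmin_val_nonmin ?s_n.
have lt_row := ltn_row_index lt_k; have lt_col := ltn_col_index lt_k.
rewrite s_n in lt_row lt_col; rewrite posE valE.
apply/and4P/eqP => [[le_col /forallP max_col le_row /forallP min_row]|[<- <-]].
  have := max_col (Ordinal lt_col); have := min_row (Ordinal lt_row).
  rewrite posE valE /= !leqnn /= => ge_row ge_col.
  by congr (_, _); apply/eqP; rewrite eqn_leq ?le_row ?ge_row ?le_col ?ge_col.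
by split=> //; apply/forallP => j; rewrite ?posE ?valE implybb.
Qed.

Definition nested (x y : nat * nat) := (y.1 <= x.1) && (x.2 <= y.2).

Definition crossing (x y : nat * nat) := [&& x.1 < y.1, x.2 < y.2 & y.1 <= x.2].

Definition laminar (s : seq nat) (L : nat -> nat * nat) : Prop :=
  forall i j, i < j -> j < size s ->
  if nth 0 s i < nth 0 s j then nested (L i) (L j)
  else (L i == L j) || ((L i).2 < (L j).1).

(* Rows are numbered from top to bottom, hence the dual orders. *)
Definition reading (x : nat * nat) : nat *l nat^d := (x.2, x.1).

Definition altitude (x : nat * nat) : nat^d *l nat := x.

Lemma le_reading x y :
  (reading x <= reading y)%O = (x.2 < y.2) || (x.2 == y.2) && (y.1 <= x.1).
Proof. by rewrite /reading lexi_pair leEdual !leEnat /=; lia. Qed.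

Lemma lt_altitude x y :
  (altitude x < altitude y)%O = (y.1 < x.1) || (y.1 == x.1) && (x.2 < y.2).
Proof.
case: x y => [r c] [r' c'].
by rewrite /altitude ltxi_pair !leEdual !leEnat ltEnat /=; lia.
Qed.

Lemma reading_inj : injective reading.
Proof. by move=> [r c] [r' c'] [-> ->]. Qed.

Lemma altitude_inj : injective altitude.
Proof. by []. Qed.

Section Laminar.
Variables (s : seq nat) (L : nat -> nat * nat).

Lemma laminar_of_orders :
  (forall i j, i < j < size s -> (reading (L i) <= reading (L j))%O) ->
  (forall i j, i < j < size s -> L i <> L j ->
     (nth 0 s i < nth 0 s j) = (altitude (L i) < altitude (L j))%O) ->
  (forall i j, i < size s -> j < size s -> ~~ crossing (L i) (L j)) ->
  laminar s L.
Proof.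
move=> read alt nocross i j ij lt_j.
have := read i j; have := nocross i j (ltn_trans ij lt_j) lt_j.
rewrite ij lt_j le_reading /crossing /nested => no_cross /(_ isT) read_ij.
have [->|/eqP L_ij] := eqVneq (L i) (L j); first by rewrite !leqnn; case: ifP.
rewrite alt ?ij // lt_altitude; move/eqP: L_ij; rewrite -pair_eqE /=.
by case: ifP; lia.
Qed.

Hypothesis L_interval : forall k, k < size s -> (L k).1 <= (L k).2.
Hypothesis s_laminar : laminar s L.

Lemma laminar_cases i j : i < j -> j < size s ->
  (nth 0 s i < nth 0 s j) && nested (L i) (L j) ||
  (nth 0 s j <= nth 0 s i) && ((L i == L j) || ((L i).2 < (L j).1)).
Proof. by move=> ij lt_j; have := s_laminar ij lt_j; case: ltnP => //= _ ->. Qed.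

Lemma laminar_reading i j : i <= j -> j < size s ->
  (reading (L i) <= reading (L j))%O.
Proof.
rewrite leq_eqVlt => /predU1P[->//|ij] lt_j.
have := L_interval (ltn_trans ij lt_j); have := L_interval lt_j.
by have := laminar_cases ij lt_j; rewrite le_reading /nested -pair_eqE /=; lia.
Qed.

Lemma laminar_altitude i j : uniq s -> i < size s -> j < size s -> L i != L j ->
  (nth 0 s i < nth 0 s j) = (altitude (L i) < altitude (L j))%O.
Proof.
move=> s_uniq lt_i lt_j L_ij.
have incr k l : k < l -> l < size s -> L k != L l ->
    (nth 0 s k < nth 0 s l) = (altitude (L k) < altitude (L l))%O.
  move=> kl lt_l L_kl; have := L_interval (ltn_trans kl lt_l); have := L_interval lt_l.
  move: L_kl; have := laminar_cases kl lt_l.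
  by rewrite lt_altitude /nested -!pair_eqE /=; lia.
have [ij|ji|e] := ltngtP i j; [exact: incr | | by rewrite e eqxx in L_ij].
have s_ij : nth 0 s i != nth 0 s j by rewrite nth_uniq // gtn_eqF.
rewrite ltNge le_eqVlt (inj_eq altitude_inj) eq_sym (negbTE L_ij) /= -incr //.
  by rewrite -leqNgt [RHS]leq_eqVlt (negbTE s_ij).
by rewrite eq_sym.
Qed.

Lemma laminar_noncrossing i j : i < size s -> j < size s -> ~~ crossing (L i) (L j).
Proof.
move=> lt_i lt_j; have := L_interval lt_i; have := L_interval lt_j.
have [ij|ji|->] := ltngtP i j; last by rewrite /crossing ltnn.
- by have := laminar_cases ij lt_j; rewrite /crossing /nested -pair_eqE /=; lia.
- by have := laminar_cases ji lt_i; rewrite /crossing /nested -pair_eqE /=; lia.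
Qed.

Lemma laminar_const_separable_basis p I : separable_basis p -> occurs_at s p I ->
  {in I, forall k, L k = L (head 0 I)}.
Proof.
move=> p_basis I_occ; have size_I : size I = 4.
  by rewrite (size_occurs_at I_occ); case: p_basis => ->.
case: I size_I I_occ => [|a [|b [|c [|d [|? ?]]]]] //= _ I_occ.
have [[ab bc cd lt_d] vals] : [/\ a < b, b < c, c < d & d < size s] /\
    ((nth 0 s c < nth 0 s a < nth 0 s d) && (nth 0 s d < nth 0 s b) ||
     (nth 0 s b < nth 0 s d < nth 0 s a) && (nth 0 s a < nth 0 s c)).
  case: p_basis I_occ => -> => [/occurs_at_2413|/occurs_at_3142] [abcd [-> -> ->]].
    by split.
  by rewrite orbT.
have lt_c := ltn_trans cd lt_d; have lt_b := ltn_trans bc lt_c.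
have lt_a := ltn_trans ab lt_b; have ac := ltn_trans ab bc; have bd := ltn_trans bc cd.
move: (L_interval lt_a) (L_interval lt_b) (L_interval lt_c) (L_interval lt_d).
move: (laminar_cases ab lt_b) (laminar_cases ac lt_c) (laminar_cases bc lt_c).
move: (laminar_cases (ltn_trans ab bd) lt_d) (laminar_cases bd lt_d).
move: (laminar_cases cd lt_d); rewrite /nested -!pair_eqE /= => *.
by move=> k; rewrite !inE => /or4P[]/eqP->; apply/eqP; rewrite -pair_eqE /=; lia.
Qed.

(* The intervals of the entries above and to the right of [x] contain that of
   [x], hence are not disjoint, so among these entries only equal intervals give
   descents. *)
Lemma laminar_const_osum1 x J p : is_perm p -> sum_indecomposable p ->
  occurs_at s (osum [:: 1] p) (x :: J) -> {in J, forall k, L k = L (head 0 J)}.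
Proof.
move=> p_perm p_ind /(occurs_at_osum1 _ _ _ p_perm)[lt_x x_J J_occ].
have [J_sorted _ [_ so]] := J_occ; have size_J := size_occurs_at J_occ.
have nth_J i : i < size p -> nth 0 J i \in J by rewrite -size_J; apply: mem_nth.
have lt_J i : i < size p -> nth 0 J i < size s by move=> /nth_J/(occurs_at_lt J_occ).
have J_mono i j : i <= j < size p -> nth 0 J i <= nth 0 J j.
  rewrite leq_eqVlt => /andP[/predU1P[->//|ij] lt_j].
  by apply/ltnW/(sorted_ltn_nth ltn_trans); rewrite ?inE ?size_J // (ltn_trans ij).
suff const i : i < size p -> L (nth 0 J i) = L (nth 0 J 0).
  by move=> k /(nthP 0)[i]; rewrite size_J => /const + <-; rewrite nth0.
apply: (sum_indecomposable_const (L := fun i => L (nth 0 J i)) p_perm p_ind).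
  move=> {}i j k /andP[ij jk] lt_k L_ik; apply/reading_inj/le_anti.
  rewrite laminar_reading ?J_mono ?ij ?(leq_ltn_trans jk) ?lt_J //=.
    by rewrite L_ik laminar_reading ?J_mono ?jk ?lt_J.
  exact: leq_ltn_trans lt_k.
move=> {}i j /andP[ij lt_j] L_ij; have lt_i := ltn_trans ij lt_j.
have [xi si] := x_J _ (nth_J _ lt_i).
have [xj sj] := x_J _ (nth_J _ lt_j).
rewrite -so ?size_map ?size_J // !(nth_map 0) ?size_J //.
have J_ij : nth 0 J i < nth 0 J j.
  by apply: (sorted_ltn_nth ltn_trans); rewrite ?inE ?size_J.
have := L_interval lt_x.
have := laminar_cases J_ij (lt_J _ lt_j); rewrite (introF eqP L_ij) /=.
have := laminar_cases xi (lt_J _ lt_i); have := laminar_cases xj (lt_J _ lt_j).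
by rewrite /nested -!pair_eqE /=; lia.
Qed.

End Laminar.

Section OverlappingDescent.
Variables (s : seq nat) (i j : nat).
Hypotheses (s_uniq : uniq s) (ij : i < j) (lt_j : j < size s).
Hypotheses (desc : nth 0 s j < nth 0 s i) (overlap : row_index s j <= col_index s i).

Let lt_i : i < size s := ltn_trans ij lt_j.

Lemma overlapping_descent_nonmin_left : ~~ is_lrmin s i.
Proof.
apply/negP => i_min; have := ltn_lrmin_val_row j (ltn_col_index lt_i).
by rewrite /lrmin_val lrmin_pos_col // desc ltnNge overlap.
Qed.

Lemma overlapping_descent_nonmin_right : ~~ is_lrmin s j.
Proof.
apply/negP => j_min; have := leq_lrmin_pos (ltn_col_index lt_j) lt_i.
by rewrite lrmin_pos_col // -lrmin_row_col // overlap leqNgt ij.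
Qed.

Let pos_row : lrmin_pos s (row_index s j) < i.
Proof.
by rewrite ltn_lrmin_pos_nonmin ?overlapping_descent_nonmin_left ?ltn_row_index.
Qed.

Let val_row : lrmin_val s (row_index s j) < nth 0 s j.
Proof.
by rewrite ltn_lrmin_val_nonmin ?overlapping_descent_nonmin_right ?ltn_row_index.
Qed.

Lemma overlapping_descent_2413 :
  col_index s i < col_index s j -> contains s [:: 2; 4; 1; 3].
Proof.
move=> lt_col; apply/containsP.
exists [:: lrmin_pos s (row_index s j); i; lrmin_pos s (col_index s j); j].
apply/occurs_at_2413; do 2!split; rewrite ?pos_row ?val_row //.
- by rewrite ltnNge leq_lrmin_pos ?ltn_col_index // -ltnNge.
- by rewrite ltn_lrmin_pos_nonmin ?overlapping_descent_nonmin_right ?ltn_col_index.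
- exact/ltn_lrmin_val/ltn_col_index/lt_j/leq_ltn_trans/lt_col.
Qed.

Lemma overlapping_descent_3142 :
  row_index s i < row_index s j -> contains s [:: 3; 1; 4; 2].
Proof.
move=> lt_row; apply/containsP; have lt_m := ltn_row_index lt_j.
have pred_lt : (row_index s j).-1 < row_index s j.
  by rewrite prednK ?(leq_ltn_trans _ lt_row).
have pred_lt_m := ltn_trans pred_lt lt_m.
exists [:: lrmin_pos s (row_index s j).-1; lrmin_pos s (row_index s j); i; j].
apply/occurs_at_3142; do 2!split; rewrite -?/(lrmin_val s _) ?pos_row ?val_row //.
- by rewrite ltn_lrmin_pos.
- by rewrite ltn_lrmin_val_row.
- by rewrite ltn_lrmin_val_nonmin ?overlapping_descent_nonmin_left //; lia.
Qed.

End OverlappingDescent.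

Lemma label_interval s k : k < size s -> (label s k).1 <= (label s k).2.
Proof. exact: leq_row_col. Qed.

Lemma label_laminar s : uniq s ->
  (forall p, separable_basis p -> ~ contains s p) -> laminar s (label s).
Proof.
move=> s_uniq avoids i j ij lt_j; rewrite /nested /label /=.
case: ltnP => [asc|]; first by rewrite leq_row_index ?leq_col_index // ltnW.
rewrite leq_eqVlt nth_uniq ?(ltn_trans ij) // gtn_eqF //= => desc.
have [overlap|] := leqP (row_index s j) (col_index s i); last by rewrite orbT.
have row_ge : row_index s j <= row_index s i.
  rewrite leqNgt; apply/negP => /(overlapping_descent_3142 s_uniq ij lt_j desc overlap).
  by apply: avoids; right.
have col_ge : col_index s j <= col_index s i.
  rewrite leqNgt; apply/negP => /(overlapping_descent_2413 s_uniq ij lt_j desc overlap).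
  by apply: avoids; left.
rewrite xpair_eqE !eqn_leq row_ge col_ge leq_row_index ?(ltnW desc) //.
by rewrite leq_col_index // ltnW.
Qed.

Definition cell_word s x := [seq nth 0 s k | k <- iota 0 (size s) & occupies s x k].

Lemma cell_word_uniq s x : uniq s -> uniq (cell_word s x).
Proof.
move=> s_uniq; rewrite map_inj_in_uniq ?filter_uniq ?iota_uniq // => i j.
rewrite !mem_filter !mem_iota => /andP[_ lt_i] /andP[_ lt_j] /eqP.
by rewrite nth_uniq // => /eqP.
Qed.

Lemma down_edgeE n (c d : cell n) : down_edge c d = crossing (interval c) (interval d).
Proof.
rewrite /down_edge /crossing /=; case: ltnP => //= row_cd; case: ltnP => //= col_cd.
apply/forallP/idP => [/(_ (row d, col c))|corner [x y]] /=.
  by rewrite /in_staircase /= !leqnn (ltnW row_cd) (ltnW col_cd).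
by rewrite /in_staircase /=; apply/implyP; lia.
Qed.

Section Encoding.
Variables (n : nat) (s : seq nat).
Hypotheses (s_uniq : uniq s) (s_n : size (lrmins s) = n).

Lemma exists_label_interval k : k < size s -> exists c : cell n, interval c = label s k.
Proof.
by move=> lt_k; apply: exists_interval; rewrite ?leq_row_col -?s_n ?ltn_col_index.
Qed.

Lemma SE_cell_word (c : cell n) : SE n s c = std (cell_word s (interval c)).
Proof.
rewrite ffunE; congr (std (map _ _)); apply: eq_in_filter => k.
by rewrite mem_iota => /= lt_k; rewrite in_cellE.
Qed.

Lemma is_perm_SE (c : cell n) : is_perm (SE n s c).
Proof. by rewrite SE_cell_word is_perm_rank_seq ?cell_word_uniq. Qed.

Lemma contains_SEP (c : cell n) p : contains (SE n s c) p <->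
  exists2 I, occurs_at s p I & all (occupies s (interval c)) I.
Proof.
have filterP := contains_filterP s (occupies s (interval c)) p.
have stdP := contains_std (cell_word s (interval c)) p.
by rewrite SE_cell_word; split=> [/stdP/filterP|/filterP/stdP].
Qed.

Lemma contains_SE (c : cell n) p : contains (SE n s c) p -> contains s p.
Proof. by case/contains_SEP => I I_occ _; apply/containsP; exists I. Qed.

(* The left-to-right minimum of the row of [c] is below and to the left of every
   entry in [c]. *)
Lemma contains_SE_osum1 (c : cell n) p :
  is_perm p -> contains (SE n s c) p -> contains s (osum [:: 1] p).
Proof.
move=> p_perm /contains_SEP[I I_occ /allP I_c]; apply/containsP.
have lt_row : row c < size (lrmins s) by rewrite s_n.
exists (lrmin_pos s (row c) :: I); apply/occurs_at_osum1 => //.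
split=> // [|k k_I]; first by have [] := lrmin_posP lt_row.
have lt_k := occurs_at_lt I_occ k_I.
have /andP[k_nonmin /eqP[row_k col_k]] := I_c k k_I; split.
  by rewrite ltn_lrmin_pos_nonmin // -row_k leq_row_col.
by rewrite -/(lrmin_val s _) ltn_lrmin_val_nonmin // row_k.
Qed.

Lemma SE_neq0 (c : cell n) : SE n s c <> [::] ->
  exists2 k, k < size s & label s k = interval c.
Proof.
rewrite SE_cell_word /cell_word; case seq_c: [seq k <- _ | _ ] => [|k ks] // _.
have := mem_head k ks; rewrite -seq_c mem_filter mem_iota.
by case/andP => /andP[_ /eqP label_k] /= lt_k; exists k.
Qed.

Lemma contains_SE_of_const p I : p <> [::] -> occurs_at s p I ->
  {in I, forall k, label s k = label s (head 0 I)} ->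
  {in I, forall k, ~~ is_lrmin s k} -> exists c : cell n, contains (SE n s c) p.
Proof.
move=> p_neq0 I_occ const nonmin.
have head_I : head 0 I \in I.
  by have := size_occurs_at I_occ; case: (I) => [/esym/size0nil|] // *; apply: mem_head.
have [c label_c] := exists_label_interval (occurs_at_lt I_occ head_I).
exists c; apply/contains_SEP; exists I => //; apply/allP => k k_I.
by rewrite /occupies nonmin // label_c const /=.
Qed.

Lemma const_label_nonmin p I i : i < size p -> nth 0 p i < nth 0 p 0 ->
  occurs_at s p I -> {in I, forall k, label s k = label s (head 0 I)} ->
  {in I, forall k, ~~ is_lrmin s k}.
Proof.
move=> lt_i p_i I_occ const k k_I; apply/negP => k_min.
have size_I := size_occurs_at I_occ; have [I_sorted _ [_ so]] := I_occ.
have I_gt0 : 0 < size I by rewrite size_I (leq_ltn_trans _ lt_i).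
have first l : l \in I -> k <= l /\ nth 0 s k <= nth 0 s l.
  by move=> l_I; apply: lrmin_first; rewrite ?const ?(occurs_at_lt I_occ).
have k_head : k = nth 0 I 0.
  apply/eqP; rewrite eqn_leq (first _ (mem_nth 0 I_gt0)).1 andTb.
  have [l lt_l <-] := nthP 0 k_I.
  by rewrite (sorted_leq_nth leq_trans leqnn) ?inE // (sub_sorted ltnW).
rewrite -size_I in lt_i; have := so i 0; rewrite size_map !(nth_map 0) // p_i -k_head.
by move=> /(_ lt_i I_gt0); rewrite ltnNge (first _ (mem_nth 0 lt_i)).2.
Qed.

Hypothesis s_laminar : laminar s (label s).

Lemma SE_independent (c d : cell n) :
  SE n s c <> [::] -> SE n s d <> [::] -> ~~ down_core c d.
Proof.
move=> /SE_neq0[k lt_k label_k] /SE_neq0[l lt_l label_l].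
rewrite /down_core !down_edgeE -label_k -label_l.
by rewrite negb_or !(laminar_noncrossing (@label_interval s)).
Qed.

Lemma contains_separable_basis_SE p : separable_basis p -> contains s p ->
  exists c : cell n, contains (SE n s c) p.
Proof.
move=> p_basis /containsP[I I_occ].
have const := laminar_const_separable_basis (@label_interval s) s_laminar p_basis I_occ.
have [i lt_i p_i] : exists2 i, i < size p & nth 0 p i < nth 0 p 0.
  by case: p_basis => ->; [exists 2 | exists 1].
have nonmin := const_label_nonmin lt_i p_i I_occ const.
by apply: contains_SE_of_const I_occ const nonmin; case: p_basis => ->.
Qed.

Lemma contains_osum1_SE p : is_perm p -> p <> [::] -> sum_indecomposable p ->
  contains s (osum [:: 1] p) -> exists c : cell n, contains (SE n s c) p.
Proof.
move=> p_perm p_neq0 p_ind /containsP[[|x J] xJ_occ].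
  by have := size_occurs_at xJ_occ.
have const := laminar_const_osum1 (@label_interval s) s_laminar p_perm p_ind xJ_occ.
have [_ x_J J_occ] := (occurs_at_osum1 _ _ _ p_perm).1 xJ_occ.
apply: (contains_SE_of_const p_neq0 J_occ const) => k k_J.
have [xk sk] := x_J k k_J; apply/negP => /(is_lrminP (occurs_at_lt J_occ k_J))/(_ x xk).
by rewrite ltnNge ltnW.
Qed.

End Encoding.

(* The local value 0 stands for the left-to-right minimum of a diagonal cell. *)
Definition extended n (f : filling n) (c : cell n) : seq nat :=
  nseq (row c == col c) 0 ++ f c.

Definition cells n : seq (cell n) :=
  sort (relpre (reading \o @interval n) <=%O) (enum {: cell n}).

Definition points n (f : filling n) : seq (nat * nat * nat) :=
  [seq (interval c, v) | c <- cells n, v <- extended f c].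

Definition height (z : nat * nat * nat) : (nat^d *l nat) *l nat := z.

Definition staircase_word n (f : filling n) : seq nat :=
  rank_seq (map height (points f)).

Lemma lt_height z w : (height z < height w)%O =
  if z.1 == w.1 then z.2 < w.2 else (altitude z.1 < altitude w.1)%O.
Proof.
case: z w => [[r c] v] [[r' c'] v']; rewrite lt_altitude /height ltxi_pair !lexi_pair.
by rewrite xpair_eqE !leEdual !leEnat ltEnat /=; case: ifP; lia.
Qed.

Section Points.
Variables (n : nat) (f : filling n).

Lemma mem_cells c : c \in cells n.
Proof. by rewrite mem_sort mem_enum. Qed.

Lemma cells_uniq : uniq (cells n).
Proof. by rewrite sort_uniq enum_uniq. Qed.

Lemma mem_pointsP z :
  reflect (exists2 c, z.1 = interval c & z.2 \in extended f c) (z \in points f).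
Proof.
apply: (iffP allpairsPdep) => [[c [v [_ v_c ->]]]|[c z_c v_c]]; first by exists c.
by exists c, z.2; rewrite mem_cells -z_c -surjective_pairing.
Qed.

Lemma filter_points c :
  [seq z <- points f | z.1 == interval c] = [seq (interval c, v) | v <- extended f c].
Proof.
by rewrite (@filter_allpairs_dep _ _ _ _ _ _ _ c) ?cells_uniq ?mem_cells.
Qed.

Lemma points_reading :
  pairwise (relpre fst (relpre reading <=%O)) (points f).
Proof.
apply: (pairwise_allpairs_dep (r := relpre (reading \o @interval n) <=%O)).
- by move=> c; apply/(pairwiseP 0) => *; rewrite /= lexx.
- by [].
rewrite -sorted_pairwise; last by move=> c d e; apply: le_trans.
by apply: sort_sorted => c d; apply: le_total.
Qed.

Hypothesis f_perm : forall c, is_perm (f c).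

Lemma extended_gt0 c k : 0 < k < size (extended f c) -> 0 < nth 0 (extended f c) k.
Proof.
case: k => // k; rewrite /extended; case: (row c == col c) => /= lt_k;
  exact: is_perm_gt0 (f_perm c) (mem_nth _ lt_k).
Qed.

Lemma mem0_extended c : (0 \in extended f c) = (row c == col c).
Proof.
rewrite /extended mem_cat mem_nseq eqxx andbT orbC; case f0: (0 \in f c) => /=.
  by have := is_perm_gt0 (f_perm c) f0.
by case: (row c == col c).
Qed.

Lemma extended_uniq c : uniq (extended f c).
Proof.
have := mem0_extended c; rewrite /extended; case: (row c == col c) => /=.
  by rewrite is_perm_uniq // andbT => _; apply/negP => /(is_perm_gt0 (f_perm c)).
by rewrite is_perm_uniq.
Qed.

Lemma points_uniq : uniq (points f).
Proof.
apply: allpairs_uniq_dep cells_uniq _ _ => [c _|[c v] [d w] _ _ /= [row_cd col_cd ->]].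
  exact: extended_uniq.
by have -> : c = d by apply: interval_inj; rewrite /interval row_cd col_cd.
Qed.

Lemma points_min_first : pairwise (fun z w => (z.1 == w.1) ==> (0 < w.2)) (points f).
Proof.
apply: (pairwise_allpairs_dep (r := fun c d => c != d)) => [c|c d v w cd|].
- apply/(pairwiseP 0) => i j _ lt_j ij; rewrite eqxx extended_gt0 //.
  by rewrite (leq_ltn_trans _ ij).
- by rewrite (inj_eq (@interval_inj n)) (negbTE cd).
- by rewrite -uniq_pairwise cells_uniq.
Qed.

Lemma is_perm_staircase_word : is_perm (staircase_word f).
Proof. by rewrite is_perm_rank_seq // map_inj_uniq // points_uniq. Qed.

End Points.

Definition rank s k := count (<= nth 0 s k)%O (cell_word s (label s k)).

Definition point s k := (label s k, rank s k).

Section LeftInverse.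
Variables (n : nat) (s : seq nat).
Hypotheses (s_uniq : uniq s) (s_n : size (lrmins s) = n).
Hypothesis s_laminar : laminar s (label s).

Lemma rank_lrmin k : k < size s -> is_lrmin s k -> rank s k = 0.
Proof.
move=> lt_k k_min; apply/eqP; rewrite -leqn0 leqNgt -has_count; apply/hasPn.
move=> _ /mapP[i + ->]; rewrite mem_filter mem_iota /=.
move=> /andP[/andP[i_nonmin /eqP label_i] lt_i]; rewrite leEnat -ltnNge ltn_neqAle.
rewrite (lrmin_first lt_k lt_i k_min (esym label_i)).2 andbT nth_uniq //.
by apply: contraNneq i_nonmin => <-.
Qed.

Lemma ltn_rank i j : i < size s -> j < size s -> label s i = label s j ->
  (rank s i < rank s j) = (nth 0 s i < nth 0 s j).
Proof.
move=> lt_i lt_j label_ij.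
have incr k l : k < size s -> l < size s -> label s k = label s l ->
    nth 0 s k < nth 0 s l -> rank s k < rank s l.
  move=> lt_k lt_l label_kl s_kl; rewrite /rank label_kl.
  apply: (@leq_ltn_trans (count (< nth 0 s l)%O (cell_word s (label s l)))).
    by apply: sub_count => v /= /le_lt_trans->.
  rewrite count_lt_le_mem; apply/map_f.
  rewrite mem_filter mem_iota lt_l /occupies eqxx !andbT.
  apply: contraL s_kl => l_min; rewrite -leqNgt.
  by have [] := lrmin_first lt_l lt_k l_min (esym label_kl).
case: (ltngtP (nth 0 s i) (nth 0 s j)) => [/incr->//|/incr lt_rank|s_ij].
- by rewrite ltnNge ltnW ?lt_rank.
- by rewrite /rank label_ij s_ij ltnn.
Qed.

Lemma SE_rank (c : cell n) :
  SE n s c = [seq rank s k | k <- iota 0 (size s) & occupies s (interval c) k].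
Proof.
rewrite SE_cell_word // std_rank_seq /rank_seq {2}/cell_word -map_comp.
apply/eq_in_map => k; rewrite mem_filter => /andP[/andP[_ /eqP label_k] _].
by rewrite /rank label_k.
Qed.

Lemma filter_label_diag j : j < size (lrmins s) ->
  [seq k <- iota 0 (size s) | label s k == (j, j)] =
  lrmin_pos s j :: [seq k <- iota 0 (size s) | occupies s (j, j) k].
Proof.
move=> lt_j; have [lt_p p_min] := lrmin_posP lt_j; have label_p := label_lrmin_pos lt_j.
have filter_sorted a : sorted ltn [seq k <- iota 0 (size s) | a k].
  exact/(sorted_filter ltn_trans)/iota_ltn_sorted.
apply: lt_sorted_eq => //.
  rewrite /= (path_sortedE ltn_trans) filter_sorted andbT.
  apply/allP => k; rewrite mem_filter mem_iota /=.
  move=> /andP[/andP[k_nonmin /eqP label_k] lt_k].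
  by rewrite ltn_lrmin_pos_nonmin //; case: label_k => _ ->.
move=> k; rewrite inE !mem_filter mem_iota /= add0n /occupies.
have [->|k_p] := eqVneq k (lrmin_pos s j); first by rewrite label_p eqxx lt_p.
case: (label s k =P (j, j)) => [[_ col_k]|]; rewrite ?andbF //= andbT.
case lt_k: (k < size s); rewrite ?andbF // andbT; apply/esym.
by apply: contra k_p => k_min; rewrite -col_k lrmin_pos_col.
Qed.

Lemma extended_SE (c : cell n) :
  extended (SE n s) c = [seq rank s k | k <- iota 0 (size s) & label s k == interval c].
Proof.
rewrite /extended SE_rank; case: (row c =P col c) => [row_col|row_col] /=.
  have lt_c : col c < size (lrmins s) by rewrite s_n.
  rewrite /interval row_col filter_label_diag //= rank_lrmin //.
  - by have [] := lrmin_posP lt_c.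
  - by have [] := lrmin_posP lt_c.
congr map; apply: eq_in_filter => k; rewrite mem_iota /= => lt_k; rewrite /occupies.
case: eqP => [[row_k col_k]|]; rewrite ?andbF // andbT.
by apply/negP => /(lrmin_row_col lt_k); rewrite row_k col_k => /val_inj.
Qed.

Lemma points_SE : points (SE n s) = [seq point s k | k <- iota 0 (size s)].
Proof.
have le_anti : antisymmetric (relpre reading <=%O).
  by move=> x y /le_anti/reading_inj.
apply: (eq_pairwise_filter (key := fst)) le_anti (points_reading _) _ _.
  rewrite pairwise_map; apply/(pairwiseP 0) => i j.
  rewrite !inE size_iota => lt_i lt_j ij; rewrite /= !nth_iota //.
  by rewrite (laminar_reading (@label_interval s)) // ltnW.
move=> z z_in; have [c ->] : exists c : cell n, z.1 = interval c.
  move: z_in; rewrite mem_cat => /orP[/mem_pointsP[c z_c _]|/mapP[k]].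
    by exists c.
  rewrite mem_iota => /= lt_k ->; have [c label_c] := exists_label_interval s_n lt_k.
  by exists c.
rewrite filter_points extended_SE filter_map -map_comp; apply/eq_in_map => k.
by rewrite mem_filter /= => /andP[/eqP label_k _]; rewrite /point label_k.
Qed.

Lemma same_order_staircase_word : same_order (staircase_word (SE n s)) s.
Proof.
have size_points : size (points (SE n s)) = size s.
  by rewrite points_SE size_map size_iota.
split=> [|i j]; rewrite size_rank_seq size_map size_points // => lt_i lt_j.
rewrite (ltn_rank_seq (height (point s 0))) ?size_map ?size_points //.
rewrite !(nth_map (point s 0)) ?size_points // points_SE !(nth_map 0) ?size_iota //.
rewrite !nth_iota // !add0n lt_height /=.
case: eqP => [/ltn_rank->//|/eqP label_ij].
by rewrite -(laminar_altitude (@label_interval s)).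
Qed.

End LeftInverse.

Lemma SEK n s : is_perm s -> size (lrmins s) = n -> laminar s (label s) ->
  staircase_word (SE n s) = s.
Proof.
move=> s_perm s_n s_laminar; have s_uniq := is_perm_uniq s_perm.
apply: perm_same_order => //; last exact: same_order_staircase_word.
exact/is_perm_staircase_word/is_perm_SE.
Qed.

Definition diagonal_minima n s (L : nat -> nat * nat) (p : nat -> nat) : Prop :=
  forall j, j < n ->
  [/\ p j < size s, L (p j) = (j, j)
    & forall k, k < size s -> L k = (j, j) -> p j <= k /\ nth 0 s (p j) <= nth 0 s k].

Section DiagonalMinima.
Variables (n : nat) (s : seq nat) (L : nat -> nat * nat) (p : nat -> nat).
Hypothesis s_uniq : uniq s.
Hypothesis L_interval : forall k, k < size s -> (L k).1 <= (L k).2.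
Hypothesis L_lt : forall k, k < size s -> (L k).2 < n.
Hypothesis s_laminar : laminar s L.
Hypothesis p_min : diagonal_minima n s L p.

Lemma leq_diag_pos j k : j < n -> k < size s -> (p j <= k) = (j <= (L k).2).
Proof.
move=> lt_j lt_k; have [lt_p L_p p_first] := p_min lt_j; have Lk := L_interval lt_k.
have [L_k|/eqP L_k] := eqVneq (L k) (j, j).
  by rewrite L_k leqnn (p_first k lt_k L_k).1.
have [pk|kp] := leqP (p j) k.
  have := laminar_reading L_interval s_laminar pk lt_k.
  by rewrite L_p le_reading /=; lia.
have := laminar_reading L_interval s_laminar (ltnW kp) lt_p; rewrite L_p le_reading /=.
by move/eqP: L_k; rewrite -pair_eqE /=; lia.
Qed.

Lemma ltn_diag_val j k : j < n -> k < size s ->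
  (nth 0 s k < nth 0 s (p j)) = (j < (L k).1).
Proof.
move=> lt_j lt_k; have [lt_p L_p p_first] := p_min lt_j; have Lk := L_interval lt_k.
have [L_k|L_k] := eqVneq (L k) (j, j).
  by rewrite L_k ltnn ltnNge (p_first k lt_k L_k).2.
rewrite (laminar_altitude L_interval s_laminar) // L_p // lt_altitude /=; lia.
Qed.

Lemma is_lrmin_diag k : k < size s -> is_lrmin s k = (k == p (L k).2).
Proof.
move=> lt_k; have lt_n := L_lt lt_k; have [lt_p L_p _] := p_min lt_n.
have p_le : p (L k).2 <= k by rewrite leq_diag_pos.
apply/(is_lrminP lt_k)/eqP => [k_min|k_p i ik].
  apply/eqP; rewrite eqn_leq p_le andbT leqNgt; apply/negP => /k_min.
  by rewrite ltn_diag_val // ltnNge L_interval.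
have lt_i := ltn_trans ik lt_k; have Li := L_interval lt_i.
have L_ik : (L i).2 < (L k).2 by rewrite ltnNge -leq_diag_pos // -k_p -ltnNge.
rewrite ltn_neqAle nth_uniq // gtn_eqF //= leqNgt {1}k_p ltn_diag_val //; lia.
Qed.

Lemma lrmins_diag : lrmins s = map p (iota 0 n).
Proof.
apply: lt_sorted_eq (lrmins_sorted s) _ _.
  rewrite (sorted_pairwise lt_trans) pairwise_map; apply/(pairwiseP 0) => i j.
  rewrite !inE size_iota => lt_i lt_j ij; rewrite /= !nth_iota // !add0n.
  have [lt_p L_p _] := p_min lt_i.
  by rewrite ltEnat /= ltnNge leq_diag_pos // L_p -ltnNge.
move=> k; rewrite mem_lrmins; apply/andP/mapP => [[lt_k]|[j]].
  rewrite is_lrmin_diag // => /eqP k_p; exists (L k).2 => //.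
  by rewrite mem_iota L_lt.
rewrite mem_iota => /= lt_j ->; have [lt_p L_p _] := p_min lt_j.
by rewrite is_lrmin_diag // L_p.
Qed.

Lemma size_lrmins_diag : size (lrmins s) = n.
Proof. by rewrite lrmins_diag size_map size_iota. Qed.

Lemma label_diag k : k < size s -> label s k = L k.
Proof.
move=> lt_k; have s_n := size_lrmins_diag.
have pos j : j < n -> lrmin_pos s j = p j.
  by move=> lt_j; rewrite /lrmin_pos lrmins_diag (nth_map 0) ?size_iota ?nth_iota.
have row_lt := ltn_row_index lt_k; have col_lt := ltn_col_index lt_k.
rewrite s_n in row_lt col_lt; have L_k := L_interval lt_k; have L_n := L_lt lt_k.
have colE j : j < n -> (j <= col_index s k) = (j <= (L k).2).
  by move=> lt_j; rewrite -leq_lrmin_pos ?s_n // pos // leq_diag_pos.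
have rowE j : j < n -> (j < row_index s k) = (j < (L k).1).
  by move=> lt_j; rewrite -ltn_lrmin_val_row ?s_n // /lrmin_val pos // ltn_diag_val.
have col_k : col_index s k = (L k).2.
  by apply/eqP; rewrite eqn_leq -colE // leqnn colE // leqnn.
have row_k : row_index s k = (L k).1.
  have L1_lt := leq_ltn_trans L_k L_n.
  apply/eqP; rewrite eqn_leq; apply/andP; split; rewrite leqNgt.
    by rewrite rowE // ltnn.
  by rewrite -rowE // ltnn.
by rewrite /label row_k col_k -surjective_pairing.
Qed.

End DiagonalMinima.

Section RightInverse.
Variables (n : nat) (f : filling n).
Hypothesis f_perm : forall c, is_perm (f c).
Hypothesis f_indep : forall c d, f c <> [::] -> f d <> [::] -> ~~ down_core c d.

Local Notation s := (staircase_word f).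
Local Notation pt k := (nth ((0, 0), 0) (points f) k).

Let s_uniq : uniq s := is_perm_uniq (is_perm_staircase_word f_perm).

Let size_s : size s = size (points f).
Proof. by rewrite size_rank_seq size_map. Qed.

Lemma nth_pointsP k : k < size s ->
  exists2 c, (pt k).1 = interval c & (pt k).2 \in extended f c.
Proof. by rewrite size_s => /(mem_nth ((0, 0), 0))/mem_pointsP. Qed.

Lemma nth_points_leq k : k < size s -> (pt k).1.1 <= (pt k).1.2.
Proof. by case/nth_pointsP => c -> _; exact: interval_leq. Qed.

Lemma nth_points_lt k : k < size s -> (pt k).1.2 < n.
Proof. by case/nth_pointsP => c -> _; exact: ltn_ord. Qed.

Lemma ltn_staircase_word i j : i < size s -> j < size s ->
  (nth 0 s i < nth 0 s j) = (height (pt i) < height (pt j))%O.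
Proof.
rewrite size_s => lt_i lt_j.
by rewrite (ltn_rank_seq (height ((0, 0), 0))) ?size_map // !(nth_map ((0, 0), 0)).
Qed.

(* A cell holding only a left-to-right minimum is diagonal, and diagonal
   intervals cross no interval. *)
Lemma nth_points_noncrossing i j : i < size s -> j < size s ->
  ~~ crossing (pt i).1 (pt j).1.
Proof.
have occupied v (c : cell n) :
    v \in extended f c -> row c = col c :> nat \/ f c <> [::].
  by rewrite /extended; case: eqP => [->|_]; [left | case: (f c); right].
move=> /nth_pointsP[c -> /occupied c_occ] /nth_pointsP[d -> /occupied d_occ].
have := interval_leq c; have := interval_leq d; rewrite /crossing /=.
case: c_occ d_occ => [diag_c|f_c] [diag_d|f_d]; try lia.
by have := f_indep f_c f_d; rewrite /down_core !down_edgeE => /norP[].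
Qed.

Lemma staircase_word_laminar : laminar s (fun k => (pt k).1).
Proof.
apply: laminar_of_orders => [i j /andP[ij]|i j /andP[ij lt_j] /eqP ne_ij|].
- rewrite size_s => lt_j; have /(pairwiseP ((0, 0), 0)) := points_reading f.
  by move/(_ i j); apply; rewrite ?inE // (ltn_trans ij).
- by rewrite ltn_staircase_word ?(ltn_trans ij) // lt_height (negbTE ne_ij).
- exact: nth_points_noncrossing.
Qed.

Definition diag_pos j := index ((j, j), 0) (points f).

Lemma diag_posP j : j < n -> diag_pos j < size s /\ pt (diag_pos j) = ((j, j), 0).
Proof.
move=> lt_j; have in_points : ((j, j), 0) \in points f.
  have [c c_j] := exists_interval (leqnn j) lt_j; apply/mem_pointsP; exists c => //=.
  by rewrite mem0_extended // -val_eqE /=; case: c_j => -> ->.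
by rewrite size_s index_mem nth_index.
Qed.

Lemma diag_pos_minima : diagonal_minima n s (fun k => (pt k).1) diag_pos.
Proof.
move=> j lt_j; have [lt_p pt_p] := diag_posP lt_j; rewrite pt_p.
split=> // k lt_k pt_k; split; last first.
  by rewrite leqNgt ltn_staircase_word // lt_height pt_k pt_p eqxx.
rewrite leqNgt; apply/negP => kp.
have /(pairwiseP ((0, 0), 0))/(_ k (diag_pos j)) := points_min_first f_perm.
by rewrite !inE -size_s lt_k lt_p pt_k pt_p eqxx => /(_ isT isT kp).
Qed.

Lemma label_staircase_word k : k < size s -> label s k = (pt k).1.
Proof.
exact: (label_diag s_uniq nth_points_leq nth_points_lt
  staircase_word_laminar diag_pos_minima).
Qed.

Lemma size_lrmins_staircase_word : size (lrmins s) = n.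
Proof.
exact: (size_lrmins_diag s_uniq nth_points_leq nth_points_lt
  staircase_word_laminar diag_pos_minima).
Qed.

Lemma label_laminar_staircase_word : laminar s (label s).
Proof.
move=> i j ij lt_j; rewrite !label_staircase_word ?(ltn_trans ij) //.
exact: staircase_word_laminar.
Qed.

Lemma is_lrmin_staircase_word k : k < size s -> is_lrmin s k = ((pt k).2 == 0).
Proof.
move=> lt_k.
rewrite (is_lrmin_diag s_uniq nth_points_leq nth_points_lt
  staircase_word_laminar diag_pos_minima) //.
have [_ pt_p] := diag_posP (nth_points_lt lt_k).
apply/eqP/eqP => [k_p|pt_k0]; first by rewrite k_p pt_p.
have [c pt_c v_c] := nth_pointsP lt_k; rewrite pt_k0 mem0_extended // in v_c.
rewrite -[LHS](index_uniq ((0, 0), 0) _ (points_uniq f_perm)) -?size_s // /diag_pos.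
congr index; rewrite [LHS]surjective_pairing pt_k0 pt_c /=.
by rewrite /interval (eqP v_c).
Qed.

Lemma staircase_wordK : SE n s = f.
Proof.
apply/ffunP => c; rewrite SE_cell_word ?size_lrmins_staircase_word //.
pose Q (z : nat * nat * nat) := (0 < z.2) && (z.1 == interval c).
have occupiesE k : k < size s -> occupies s (interval c) k = Q (pt k).
  move=> lt_k; rewrite /occupies is_lrmin_staircase_word // -lt0n.
  by rewrite label_staircase_word.
have -> : cell_word s (interval c) = [seq nth 0 s k | k <- iota 0 (size s) & Q (pt k)].
  by congr map; apply: eq_in_filter => k; rewrite mem_iota => /occupiesE.
rewrite (eq_std (t := [seq (pt k).2 | k <- iota 0 (size s) & Q (pt k)])); last first.
  apply/same_order_mapP => i j; rewrite !mem_filter !mem_iota.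
  move=> /andP[/andP[_ /eqP pt_i] lt_i] /andP[/andP[_ /eqP pt_j] lt_j].
  by rewrite ltn_staircase_word // lt_height pt_i pt_j eqxx.
rewrite (map_comp snd (fun k => pt k)) -(filter_map (fun k => pt k)) size_s.
rewrite -/(mkseq _ _) mkseq_nth.
rewrite (filter_predI (fun z => 0 < z.2)) filter_points filter_map -map_comp.
rewrite map_id /extended filter_cat filter_nseq mul0n cat0s.
rewrite (eq_in_filter (a2 := predT)) ?filter_predT ?std_perm //.
by move=> v /(is_perm_gt0 (f_perm c)).
Qed.

End RightInverse.

Local Open Scope classical_set_scope.

Lemma Avn_laminar n Q s : Avn n (separable_basis `|` Q) s -> laminar s (label s).
Proof.
case=> [[/is_perm_uniq s_uniq avoids] _]; apply: label_laminar => // p p_basis.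
by apply: avoids; left.
Qed.

Lemma WI_is_perm n (G : rel (cell n)) Q f c : WI G (Avp Q) f -> is_perm (f c).
Proof. by case=> _ f_Av; have [->|/eqP/f_Av[[]]] := eqVneq (f c) [::]. Qed.

Section Bijection.
Variables (P : set (seq nat)) (n : nat).
Hypothesis P_indecomposable :
  forall p, P p -> [/\ is_perm p, p <> [::] & sum_indecomposable p].

Local Notation words :=
  (Avn n (separable_basis `|` [set osum [:: 1] p | p in P])).
Local Notation fillings := (WI (@down_core n) (Avp (separable_basis `|` P))).

Lemma SE_WI s : words s -> fillings (SE n s).
Proof.
move=> s_Av; have s_laminar := Avn_laminar s_Av.
have [[/is_perm_uniq s_uniq avoids] s_n] := s_Av.
split=> [c d|c SE_c]; first exact: SE_independent.
split=> //; split; first exact: is_perm_SE.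
move=> p [p_basis|Pp]; first by move/(contains_SE s_uniq s_n); apply: avoids; left.
have [p_perm _ _] := P_indecomposable Pp; move/(contains_SE_osum1 s_uniq s_n p_perm).
by apply: avoids; right; exists p.
Qed.

Lemma Avn_of_SE s : is_perm s -> size (lrmins s) = n -> laminar s (label s) ->
  fillings (SE n s) -> words s.
Proof.
move=> s_perm s_n s_laminar [_ SE_Av]; split=> //; split=> // q.
have s_uniq := is_perm_uniq s_perm.
have SE_avoids p (c : cell n) : (separable_basis `|` P) p -> p <> [::] ->
    ~ contains (SE n s c) p.
  move=> Qp p_neq0 p_c; have [SE_c|/eqP/SE_Av[[_ avoids] _]] := eqVneq (SE n s c) [::].
    by apply: p_neq0; apply: contains_nil; rewrite -SE_c.
  exact: avoids p_c.
case=> [q_basis|[p Pp <-]].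
  case/(contains_separable_basis_SE s_uniq s_n s_laminar q_basis) => c.
  by apply: SE_avoids; [left | case: q_basis => ->].
have [p_perm p_neq0 p_ind] := P_indecomposable Pp.
case/(contains_osum1_SE s_uniq s_n s_laminar p_perm p_neq0 p_ind) => c.
by apply: SE_avoids => //; right.
Qed.

Lemma staircase_word_Avn f : fillings f -> words (staircase_word f).
Proof.
move=> f_WI; have f_perm c := WI_is_perm c f_WI; have [f_indep _] := f_WI.
apply: Avn_of_SE; rewrite ?staircase_wordK //.
- exact: is_perm_staircase_word.
- exact: size_lrmins_staircase_word.
- exact: label_laminar_staircase_word.
Qed.

End Bijection.

Theorem theorem4p5 (P : set (seq nat))
  (hP : forall p, P p -> [/\ is_perm p, p <> [::] & sum_indecomposable p])
  (n : nat) :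
  set_bij
    (Avn n ([set [:: 2; 4; 1; 3]; [:: 3; 1; 4; 2]] `|`
            [set osum [:: 1] p | p in P]))
    (WI (@down_core n)
        (Avp ([set [:: 2; 4; 1; 3]; [:: 3; 1; 4; 2]] `|` P)))
    (@SE n).
Proof.
have Avn_SEK s : Avn n (separable_basis `|` [set osum [:: 1] p | p in P]) s ->
    staircase_word (SE n s) = s.
  move=> s_Av; have [[s_perm _] s_n] := s_Av.
  exact: SEK (Avn_laminar s_Av).
split.
- exact: SE_WI.
- by move=> s t /set_mem/Avn_SEK {2}<- /set_mem/Avn_SEK {2}<- ->.
- move=> f f_WI; exists (staircase_word f); first exact: staircase_word_Avn.
  by apply: staircase_wordK => [c|]; [exact: WI_is_perm f_WI | case: f_WI].
Qed.
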